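(* Let $G$ be a subgroup of the additive group $\mathbb{Q}$ of rational numbers, endowed with the metric $|x-y|$. A metric space $(X,d)$ is isometric to $G$ if and only if $X$ is a Banakh space with $d[X^2]=G_+$.
   Context: For a metric space $(X,d)$, $d[X^2]=\{d(x,y):x,y\in X\}$ is its set of distances, and for $c\in X$, $r\in\mathbb{R}$, $\mathsf{S}(c;r)=\{x\in X:d(x,c)=r\}$. A metric space $(X,d)$ is a Banakh space if for every $c\in X$ and every $r\in d[X^2]$ there exist points $x,y\in X$ such that $\mathsf{S}(c;r)=\{x,y\}$ and $d(x,y)=2r$. For a set $G\subseteq\mathbb{R}$, $G_+=\{x\in G:x\ge 0\}$. An isometry is a surjective distance-preserving map; two metric spaces are isometric if there is an isometry between them. *)

(* Defs.v *)
From HB Require Import structures.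
From mathcomp Require Import all_boot all_order all_algebra.
From mathcomp Require Import boolp classical_sets reals topology.

Set Implicit Arguments.
Unset Strict Implicit.
Unset Printing Implicit Defensive.

Import Order.TTheory GRing.Theory Num.Theory.
Local Open Scope classical_set_scope.
Local Open Scope ring_scope.

Section MetricSpaces.
Context {R : realType}.

Definition distances (X : metricType R) : set R :=
  [set r | exists x y : X, mdist x y = r].

Definition sphere (X : metricType R) (c : X) (r : R) : set X :=
  [set x | mdist x c = r].

(* The points x and y may coincide: this happens exactly when r = 0. *)
Definition Banakh_space (X : metricType R) : Prop :=
  forall (c : X) (r : R), distances X r ->
    exists x y : X, sphere c r = [set x; y] /\ mdist x y = 2 * r.

Definition isometry (X Y : metricType R) (f : X -> Y) : Prop :=
  (forall x y : X, mdist (f x) (f y) = mdist x y) /\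
  (forall y : Y, exists x : X, f x = y).

Definition isometric (X Y : metricType R) : Prop :=
  exists f : X -> Y, isometry f.

Definition nonneg_part (A : set R) : set R := [set x | A x /\ 0 <= x].

End MetricSpaces.

(* A set of rationals, seen as a set of reals. *)
Definition real_image (R : realType) (G : {pred rat}) : set R :=
  [set ratr q | q in [set q | q \in G]].

(* The metric space carried by the subgroup G: distances are valued in R, hence
   the parameter R and the cast ratr. *)
Definition rat_space (R : realType) (G : zmodClosed rat) : Type :=
  {q : rat | q \in G}.

Section RatSpace.
Context (R : realType) (G : zmodClosed rat).

HB.instance Definition _ := Choice.copy (rat_space R G) {q : rat | q \in G}.

Definition rat_dist (x y : rat_space R G) : R := ratr `|val x - val y|.

Let rat_distxx x : rat_dist x x = 0.
Proof. by rewrite /rat_dist subrr normr0 rmorph0. Qed.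

Let rat_dist_positivity x y : rat_dist x y = 0 -> x = y.
Proof.
move=> /eqP; rewrite fmorph_eq0 normr_eq0 subr_eq0 => /eqP xy.
exact: val_inj.
Qed.

Let rat_dist_sym x y : rat_dist x y = rat_dist y x.
Proof. by rewrite /rat_dist distrC. Qed.

Let rat_dist_triangle y x z : rat_dist x z <= rat_dist x y + rat_dist y z.
Proof. by rewrite /rat_dist -rmorphD ler_rat ler_distD. Qed.

HB.instance Definition _ := @isMetric.Build R (rat_space R G) rat_dist
  rat_distxx rat_dist_positivity rat_dist_sym rat_dist_triangle.

End RatSpace.

(* Main.v *)
(* In a Banakh space, starting from c and stepping to the point opposite to the
   previous one on each sphere of radius r yields a bi-infinite walk. Any two
   steps of a walk span a distance 2r, and comparing spheres shows that any four
   steps span 4r; hence every other point of a walk of step r is a walk of step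
   2r, so that 2^k steps span 2^k r and every walk is an isometric copy of rZ.
   Any finite set of elements of G consists of multiples of a single h in G, so
   any finite set of points lies on a walk of step h through c: spheres around c
   have at most two points, and the walk already provides two. Fixing c and a at
   a distance g > 0, a point x gets as coordinate the q in G with d(x, c) = |q|
   and d(x, a) = |q - g|, and distances between coordinates are computed on
   common walks. *)
Require Import Defs.
From mathcomp Require Import all_boot all_order all_algebra.
From mathcomp Require Import boolp classical_sets reals topology.
From mathcomp Require Import zify ring lra.

Set Implicit Arguments.
Unset Strict Implicit.
Unset Printing Implicit Defensive.

Import Order.TTheory GRing.Theory Num.Theory.
Local Open Scope ring_scope.

(** * Walks in Banakh spaces *)

Section BanakhSpaces.
Context {R : realType} {X : metricType R}.
Hypothesis XB : Banakh_space X.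

Lemma Banakh_antipode (c p : X) :
  exists q : X, mdist q c = mdist p c /\ mdist p q = 2 * mdist p c.
Proof.
have : distances X (mdist p c) by exists p, c.
(* Naming the radius keeps it fixed when [p] is replaced by [x] or [y] below. *)
move: (erefl (mdist p c)); move: {2 3 4 5}(mdist p c) => r pr rD.
have [x [y [cE xy]]] := XB c rD.
have xc : mdist x c = r by change (sphere c r x); rewrite cE; left.
have yc : mdist y c = r by change (sphere c r y); rewrite cE; right.
have : sphere c r p by [].
by rewrite cE => -[->|->]; [exists y|exists x; rewrite [mdist y x]metric_sym].
Qed.

Lemma Banakh_sphere (c p q : X) :
  mdist p c = mdist q c -> p = q \/ mdist p q = 2 * mdist q c.
Proof.
move=> pq; have : distances X (mdist q c) by exists q, c.
move: (erefl (mdist q c)) pq; move: {2 3 4 5}(mdist q c) => r qr pr rD.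
have [x [y [cE xy]]] := XB c rD.
have : sphere c r p by [].
have : sphere c r q by [].
by rewrite cE => -[->|->] [->|->]; rewrite ?[mdist y x]metric_sym; tauto.
Qed.

(* Otherwise x4 = x0. With y the antipode of x2 on the sphere S(x0; 2r), the
   points x1 and x3 both lie at distance 3r from y, yet d(x1, x3) = 2r. *)
Lemma Banakh_step (r : R) (x0 x1 x2 x3 x4 : X) : 0 < r ->
  mdist x0 x1 = r -> mdist x1 x2 = r -> mdist x2 x3 = r -> mdist x3 x4 = r ->
  mdist x0 x2 = 2 * r -> mdist x1 x3 = 2 * r -> mdist x2 x4 = 2 * r ->
  mdist x0 x4 = 4 * r.
Proof.
move=> r0 d01 d12 d23 d34 d02 d13 d24.
have := @Banakh_sphere x2 x0 x4; rewrite d02 [mdist x4 _]metric_sym d24.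
case=> // [x04|->]; last by ring.
have [y [yx0 x2y]] := Banakh_antipode x0 x2.
rewrite [mdist x2 x0]metric_sym d02 in yx0 x2y.
have d30 : mdist x3 x0 = r by rewrite x04.
(* As [y] is 4r away from [x2] and 2r away from [x0], the triangle inequality bounds d(x, y) by 3r
   from below and from above. *)
have far x : mdist x0 x = r -> mdist x2 x = r -> mdist x y = 3 * r.
  move=> x0x x2x.
  have := metric_triangle x2 x y; have := metric_triangle x x0 y.
  rewrite x2y x2x [mdist x x0]metric_sym [mdist x0 y]metric_sym yx0 x0x.
  by move=> ? ?; lra.
have x1y := far x1 d01 (etrans (metric_sym _ _) d12).
have x3y := far x3 (etrans (metric_sym _ _) d30) d23.
have [x13|] := @Banakh_sphere y x1 x3 (etrans x1y (esym x3y)).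
- by move: d13; rewrite x13 mdistxx => ?; lra.
- by rewrite d13 x3y => ?; lra.
Qed.

(** The second condition forbids turning back. Both conditions are local; [walk_dist] derives all
    other distances from them. *)
Definition walk (r : R) (f : int -> X) : Prop :=
  forall i, mdist (f i) (f (i + 1)) = r /\ mdist (f i) (f (i + 2)) = 2 * r.

(** [Banakh_step] applies to any five consecutive points. The offset [i] lets the doubled walk start
    at any index. *)
Lemma walk_double (r : R) (f : int -> X) (i : int) : 0 < r ->
  walk r f -> walk (2 * r) (fun j => f (i + 2 * j)).
Proof.
move=> r0 fW j; set k := i + 2 * j.
have -> : i + 2 * (j + 1) = k + 2 by rewrite /k; ring.
have -> : i + 2 * (j + 2) = k + 1 + 1 + 1 + 1 by rewrite /k; ring.
split; first by case: (fW k).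
have two l : l + 2 = l + 1 + 1 :> int by ring.
have [d01 d02] := fW k; have [d12 d13] := fW (k + 1).
have [d23 d24] := fW (k + 1 + 1); have [d34 _] := fW (k + 1 + 1 + 1).
rewrite !two in d02 d13 d24.
by rewrite (Banakh_step r0 d01 d12 d23 d34 d02 d13 d24); ring.
Qed.

(** By induction with [r] and [f] varying: 2^(k+1) steps of [f] are 2^k steps of the doubled
    walk. *)
Lemma walk_exp2 (k : nat) (r : R) (f : int -> X) (i : int) : 0 < r ->
  walk r f -> mdist (f i) (f (i + (2 ^ k)%N%:Z)) = (2 ^ k)%N%:R * r.
Proof.
elim: k r f i => [|k IH] r f i r0 fW.
  by rewrite expn0 mul1r; case: (fW i).
have := IH (2 * r) _ 0 _ (walk_double i r0 fW).
rewrite mulr0 addr0 add0r => H.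
by rewrite expnS PoszM H ?natrM; [ring|lra].
Qed.

Lemma walk_le (r : R) (f : int -> X) (i : int) (n : nat) :
  walk r f -> mdist (f i) (f (i + n%:Z)) <= n%:R * r.
Proof.
move=> fW; elim: n => [|n IH]; first by rewrite addr0 mdistxx mul0r.
apply: le_trans (metric_triangle _ (f (i + n%:Z)) _) _.
have -> : i + n.+1%:Z = i + n%:Z + 1 by lia.
by rewrite (fW (i + n%:Z)).1 -natr1 mulrDl mul1r lerD2r.
Qed.

(* The triangle inequality bounds each d(f i, f (i + n)) above by n r, and
   equality for some power of 2 beyond n forces equality for n. *)
Lemma walk_dist (r : R) (f : int -> X) : 0 < r -> walk r f ->
  forall i j : int, mdist (f i) (f j) = `|i - j|%:~R * r.
Proof.
move=> r0 fW i j.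
have main (k : int) (n : nat) : mdist (f k) (f (k + n%:Z)) = n%:R * r.
  apply/eqP; rewrite eq_le walk_le //=.
  have n2 : (n <= 2 ^ n)%N by rewrite ltnW // ltn_expl.
  have := metric_triangle (f k) (f (k + n%:Z)) (f (k + (2 ^ n)%N%:Z)).
  have -> : k + (2 ^ n)%N%:Z = k + n%:Z + (2 ^ n - n)%N%:Z by lia.
  have := walk_le (k + n%:Z) (2 ^ n - n) fW.
  have := walk_exp2 n k r0 fW.
  have -> : k + (2 ^ n)%N%:Z = k + n%:Z + (2 ^ n - n)%N%:Z by lia.
  by move=> ->; rewrite natrB // => ? ?; lra.
wlog ij : i j / i <= j.
  by move=> H; have [/H//|/ltW/H] := leP i j; rewrite metric_sym distrC.
have -> : j = i + `|i - j|%N%:Z by lia.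
by rewrite main; congr (_ * _); rewrite -pmulrn; congr (_%:R); lia.
Qed.

(** The next point depends on the last two, so the state is a pair; this form lets [choice] return a
    transition function. *)
Lemma next_exists (p : X * X) :
  exists z : X, mdist p.2 z = mdist p.1 p.2 /\ mdist p.1 z = 2 * mdist p.1 p.2.
Proof.
have [q [qc pq]] := Banakh_antipode p.2 p.1.
by exists q; rewrite [mdist p.2 _]metric_sym.
Qed.

Lemma half_walk (a b : X) : exists u : nat -> X,
  [/\ u 0%N = a, u 1%N = b & forall n, mdist (u n) (u n.+1) = mdist a b /\
       mdist (u n) (u n.+2) = 2 * mdist a b].
Proof.
have [nxt nxtP] := choice next_exists.
pose s n := iter n (fun p => (p.2, nxt p)) (a, b).
exists (fun n => (s n).1); split=> // n.
have sE m : mdist (s m).1 (s m).2 = mdist a b.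
  by elim: m => //= m IH; rewrite (nxtP (s m)).1.
by rewrite /= (nxtP (s n)).2 sE.
Qed.

(** Two half walks leave [c] through the two points of a sphere around [c]; these are antipodal, so
    the halves fit together at [c]. *)
Lemma walk_exists (r : R) (c : X) : distances X r ->
  exists f : int -> X, f 0 = c /\ walk r f.
Proof.
move=> rD; have [a [b [cE ab]]] := XB c rD.
have ac : mdist c a = r.
  by rewrite metric_sym; have : sphere c r a by rewrite cE; left.
have bc : mdist c b = r.
  by rewrite metric_sym; have : sphere c r b by rewrite cE; right.
have [u [u0 u1 uW]] := half_walk c a; have [v [v0 v1 vW]] := half_walk c b.
rewrite ac in uW; rewrite bc in vW.
exists (fun i => match i with Posz n => u n | Negz n => v n.+1 end).
(* [Negz n] is -(n+1). Only the triples starting at -1 and -2 involve both branches of the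
   definition, hence the separate cases. *)
split=> // -[n|[|[|n]]].
- have -> : Posz n + 1 = n.+1 by lia.
  by have -> : Posz n + 2 = n.+2 by lia.
- by rewrite /= v1 u0 u1 [mdist b a]metric_sym [mdist b c]metric_sym.
- rewrite /= u0 -v0 ![mdist (v 2%N) _]metric_sym.
  by case: (vW 0%N) => _ ->; case: (vW 1%N) => ->.
- have -> : Negz n.+2 + 1 = Negz n.+1 by lia.
  have -> : Negz n.+2 + 2 = Negz n by lia.
  rewrite ![mdist (v n.+3) _]metric_sym.
  by case: (vW n.+1) => _ ->; case: (vW n.+2) => ->.
Qed.

Lemma sphere_unique (c p q z : X) :
  mdist p c = mdist z c -> mdist q c = mdist z c -> p <> q -> z = p \/ z = q.
Proof.
move=> pr qr pq; have rD : distances X (mdist z c) by exists z, c.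
have [x [y [cE _]]] := XB c rD.
have zE : sphere c (mdist z c) z by [].
have qE : sphere c (mdist z c) q by [].
have pE : sphere c (mdist z c) p by [].
move: pE qE zE pq; rewrite cE => -[->|->] [->|->] [->|->]; tauto.
Qed.

(** For nonzero [k], the points [f k] and [f (- k)] are distinct and already fill the sphere
    containing [x]. *)
Lemma walk_hit (r : R) (f : int -> X) (k : int) (x : X) : 0 < r ->
  walk r f -> mdist x (f 0) = `|k|%:~R * r -> exists j, f j = x.
Proof.
move=> r0 fW xk; have d := walk_dist r0 fW.
have [k0|k0] := eqVneq k 0.
  by exists 0; apply/esym/mdist_positivity; rewrite xk k0 normr0 mul0r.
have [|||->|->] := @sphere_unique (f 0) (f k) (f (- k)) x.
- by rewrite d subr0.
- by rewrite d subr0 normrN.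
- move/(congr1 (fun z => mdist z (f (- k)))); rewrite mdistxx d opprK => /eqP.
  by rewrite mulf_eq0 (gt_eqF r0) orbF intr_eq0 normr_eq0; lia.
- by exists k.
- by exists (- k).
Qed.

Lemma walk_opp (r : R) (f : int -> X) : walk r f -> walk r (fun i => f (- i)).
Proof.
move=> fW i; split.
- rewrite metric_sym; have := (fW (- i - 1)).1.
  have -> : - i - 1 + 1 = - i by lia.
  by have -> : - i - 1 = - (i + 1) by lia.
- rewrite metric_sym; have := (fW (- i - 2)).2.
  have -> : - i - 2 + 2 = - i by lia.
  by have -> : - i - 2 = - (i + 2) by lia.
Qed.

(** A walk from [c] meets [a] at index [m] or [- m]; in the latter case it is reversed. *)
Lemma walk_through (r : R) (c a : X) (m : int) : 0 < r -> distances X r ->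
  mdist a c = `|m|%:~R * r ->
  exists f : int -> X, [/\ walk r f, f 0 = c & f m = a].
Proof.
move=> r0 rD ac; have [f [f0 fW]] := walk_exists c rD.
have [j fj] : exists j, f j = a by apply: walk_hit fW _ => //; rewrite f0 ac.
have jm : `|j| = `|m|.
  apply/eqP; rewrite -(eqr_int R); apply/eqP.
  by apply: (mulIf (lt0r_neq0 r0)); rewrite -ac -fj -f0 (walk_dist r0 fW) subr0.
have [jE|jE] : j = m \/ j = - m by lia.
- by exists f; rewrite -jE.
- by exists (fun i => f (- i)); rewrite oppr0 -jE; split=> //; exact: walk_opp.
Qed.

End BanakhSpaces.

(** * Common measures in subgroups of the rationals *)

(** Over a common denominator, [h] is up to sign the gcd of the numerators; Bezout's identity puts
    it in [G]. *)
Lemma common_measure (G : zmodClosed rat) (a b : rat) : a \in G -> b \in G ->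
  0 < a ->
  exists h k l, [/\ h \in G, 0 < h, a = h *~ k & b = h *~ l].
Proof.
move=> aG bG a0; have [A [B [D [aE bE]]]] : exists A B D : int,
    a = A%:~R / D%:~R /\ b = B%:~R / D%:~R.
  exists (numq a * denq b), (numq b * denq a), (denq a * denq b); split.
    rewrite -[LHS]divq_num_den !rmorphM /= -mulf_div divff ?mulr1 //.
    by rewrite intr_eq0 denq_neq0.
  rewrite -[LHS]divq_num_den [denq a * _]mulrC !rmorphM /= -mulf_div.
  by rewrite divff ?mulr1 // intr_eq0 denq_neq0.
have [u [v uv]] := Bezoutz A B.
have /dvdzP[k kE] := dvdz_gcdl A B; have /dvdzP[l lE] := dvdz_gcdr A B.
have hE : a *~ u + b *~ v = (gcdz A B)%:~R / D%:~R.
  rewrite -[a *~ u]mulrzl -[b *~ v]mulrzl -uv rmorphD !rmorphM /= mulrDl.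
  by rewrite [in LHS]aE [in LHS]bE !mulrA.
set h := a *~ u + b *~ v in hE.
have hG : h \in G by rewrite rpredD // rpredMz.
have ak : a = h *~ k by rewrite hE [LHS]aE {1}kE rmorphM /= -[RHS]mulrzl mulrA.
have bl : b = h *~ l by rewrite hE [LHS]bE {1}lE rmorphM /= -[RHS]mulrzl mulrA.
have [h0|h0|h0] := ltrgt0P h.
- by exists h, k, l.
- exists (- h), (- k), (- l).
  by rewrite rpredN hG oppr_gt0 h0 !mulNrNz.
- by move: a0; rewrite ak h0 mul0rz ltxx.
Qed.

Lemma common_measure3 (G : zmodClosed rat) (a b c : rat) :
  a \in G -> b \in G -> c \in G -> 0 < a ->
  exists h k l m, [/\ h \in G, 0 < h, a = h *~ k, b = h *~ l & c = h *~ m].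
Proof.
move=> aG bG cG a0; have [h [k [l [hG h0 -> ->]]]] := common_measure aG bG a0.
have [h' [n [m [h'G h'0 -> ->]]]] := common_measure hG cG h0.
by exists h', (n * k), (n * l), m; rewrite !mulrzA.
Qed.

Lemma ratr_norm_mulrz (F : numFieldType) (h : rat) (m : int) : 0 < h ->
  ratr `|h *~ m| = `|m|%:~R * ratr h :> F.
Proof.
move=> h0; rewrite -mulrzl normrM (gtr0_norm h0) -intr_norm.
by rewrite rmorphM /= ratr_int.
Qed.

(** Squaring both equalities and subtracting leaves [p * a = q * a]. *)
Lemma eq_of_two_dists (a p q : rat) : a != 0 ->
  `|p| = `|q| -> `|p - a| = `|q - a| -> p = q.
Proof.
move=> a0 /(congr1 (fun z => z ^+ 2)); rewrite !real_normK ?num_real // => pq.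
move=> /(congr1 (fun z => z ^+ 2)); rewrite !real_normK ?num_real // => paqa.
by apply: (mulIf a0); lra.
Qed.

(** * Coordinates on a Banakh space with distances in [G] *)

Section OverGroup.
Context {R : realType} {X : metricType R} {G : zmodClosed rat}.
Hypothesis XB : Banakh_space X.
Hypothesis XG : distances X = nonneg_part (real_image G).

Lemma distancesP (r : R) :
  distances X r <-> exists2 q, q \in G & 0 <= q /\ r = ratr q.
Proof.
rewrite XG; split=> [[[q qG <-] q0]|[q qG [q0 ->]]].
- by exists q => //; rewrite ler0q in q0.
- by split; [exists q|rewrite /= ler0q].
Qed.

Lemma walk_ratr (h : rat) (f : int -> X) : 0 < h -> walk (ratr h) f ->
  forall i j, mdist (f i) (f j) = ratr `|h *~ i - h *~ j|.
Proof.
move=> h0 fW i j; rewrite (walk_dist XB _ fW) ?ltr0q //.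
by rewrite -mulrzBr ratr_norm_mulrz.
Qed.

Section Coordinate.
Context {c a : X} {g : rat}.
Hypothesis gG : g \in G.
Hypothesis g0 : 0 < g.
Hypothesis ac : mdist a c = ratr g.

Lemma ratr_walk_through (h : rat) (m : int) : h \in G -> 0 < h ->
  g = h *~ m -> exists f, [/\ walk (ratr h) f, f 0 = c & f m = a].
Proof.
move=> hG h0 gm; apply: (walk_through XB).
- by rewrite ltr0q.
- by apply/distancesP; exists h => //; rewrite ltW.
- by rewrite -ratr_norm_mulrz // ac -gm gtr0_norm.
Qed.

Lemma common_walk (x y : X) : exists h m k l f,
  [/\ h \in G, 0 < h, g = h *~ m & walk (ratr h) f] /\
  [/\ f 0 = c, f m = a, f k = x & f l = y].
Proof.
have distG z : exists2 q, q \in G & mdist z c = ratr `|q|.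
  have /distancesP[q qG [q0 ->]] : distances X (mdist z c) by exists z, c.
  by exists q; rewrite ?ger0_norm.
have [p pG xp] := distG x; have [q qG yq] := distG y.
have [h [m [k [l [hG h0 gm pk ql]]]]] := common_measure3 gG pG qG g0.
have [f [fW f0 fm]] := ratr_walk_through hG h0 gm.
have rh0 : 0 < ratr h :> R by rewrite ltr0q.
have hit z n : mdist z c = ratr `|h *~ n| -> exists j, f j = z.
  move=> zn; apply: (walk_hit XB rh0 fW (k := n)).
  by rewrite f0 zn ratr_norm_mulrz.
(* The distance to [c] determines an index only up to sign, so [i] and [j] may differ from [k] and
   [l] in sign. *)
have [i fi] := hit x k (etrans xp (congr1 (fun z => ratr `|z|) pk)).
have [j fj] := hit y l (etrans yq (congr1 (fun z => ratr `|z|) ql)).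
by exists h, m, i, j, f.
Qed.

(** The distance to [c] gives the coordinate up to sign, and the distance to [a], whose own
    coordinate is [g], selects the sign. *)
Definition coordinate (x : X) (q : rat) : Prop :=
  [/\ q \in G, mdist x c = ratr `|q| & mdist x a = ratr `|q - g|].

Lemma walk_coordinate (h : rat) (m k : int) (f : int -> X) : h \in G -> 0 < h ->
  g = h *~ m -> walk (ratr h) f -> f 0 = c -> f m = a ->
  forall q, coordinate (f k) q <-> q = h *~ k.
Proof.
move=> hG h0 gm fW f0 fm q; have d := walk_ratr h0 fW.
split=> [[qG]|->].
- rewrite -f0 -fm !d mulr0z subr0 -gm => /fmorph_inj qk /fmorph_inj qkg.
  by apply/esym; apply: (eq_of_two_dists (lt0r_neq0 g0)).
- by split; [rewrite rpredMz|rewrite -f0 d mulr0z subr0|rewrite -fm d gm].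
Qed.

Lemma coordinate_dist (x y : X) (p q : rat) :
  coordinate x p -> coordinate y q -> mdist x y = ratr `|p - q|.
Proof.
have [h [m [k [l [f [[hG h0 gm fW] [f0 fm <- <-]]]]]]] := common_walk x y.
have co j := walk_coordinate j hG h0 gm fW f0 fm.
by move=> /co -> /co ->; rewrite (walk_ratr h0 fW).
Qed.

Lemma coordinate_exists (x : X) : exists q, coordinate x q.
Proof.
have [h [m [k [l [f [[hG h0 gm fW] [f0 fm <- _]]]]]]] := common_walk x x.
by exists (h *~ k); apply/(walk_coordinate k hG h0 gm fW f0 fm).
Qed.

Lemma coordinate_surj (q : rat) : q \in G -> exists x, coordinate x q.
Proof.
move=> qG; have [h [m [k [hG h0 gm qk]]]] := common_measure gG qG g0.
have [f [fW f0 fm]] := ratr_walk_through hG h0 gm.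
by exists (f k); apply/(walk_coordinate k hG h0 gm fW f0 fm).
Qed.

Lemma Banakh_isometric_of_pair : isometric X (rat_space R G).
Proof.
have [f fP] := choice coordinate_exists.
have fG x : f x \in G by have [] := fP x.
exists (fun x => exist _ (f x) (fG x) : rat_space R G); split.
- by move=> x y; rewrite (coordinate_dist (fP x) (fP y)).
- move=> [q qG]; have [x xq] := coordinate_surj qG.
  exists x; apply: val_inj => /=.
  (* Two coordinates of the same point are at distance d(x, x) = 0, so [f x] is [q]. *)
  have := coordinate_dist (fP x) xq; rewrite mdistxx => /esym/eqP.
  by rewrite fmorph_eq0 normr_eq0 subr_eq0 => /eqP.
Qed.

End Coordinate.

Lemma Banakh_isometric : isometric X (rat_space R G).
Proof.
have [[g [gG g0]]|G0] := pselect (exists g, g \in G /\ 0 < g).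
  (* Since 0 is a distance, [X] is inhabited. *)
  have [c [p _]] : distances X 0.
    by apply/distancesP; exists 0; rewrite ?rpred0 // rmorph0.
  have gD : distances X (ratr g).
    by apply/distancesP; exists g; rewrite // ltW.
  have [x [y [cE _]]] := XB c gD.
  apply: (@Banakh_isometric_of_pair c x g gG g0).
  by change (sphere c (ratr g) x); rewrite cE; left.
(* Without positive elements [G] is trivial, so all distances vanish and [X] is a single point. *)
have {}G0 q : q \in G -> q = 0.
  move=> qG; have [q0|q0|//] := ltrgt0P q; case: G0; first by exists q.
  by exists (- q); rewrite rpredN oppr_gt0.
exists (fun=> exist _ 0 (rpred0 G) : rat_space R G); split.
- move=> x y; rewrite mdistxx.
  have /distancesP[q /G0-> [_ ->]] : distances X (mdist x y) by exists x, y.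
  by rewrite rmorph0.
- have [c _] : distances X 0.
    by apply/distancesP; exists 0; rewrite ?rpred0 // rmorph0.
  by move=> [q qG]; exists c; apply: val_inj; rewrite /= (G0 q qG).
Qed.

End OverGroup.

(** * Transfer of the metric properties of [G] along an isometry *)

Section FromIsometry.
Context {R : realType} {X : metricType R} {G : zmodClosed rat}.
Context {f : X -> rat_space R G}.
Hypothesis fI : Defs.isometry f.

Lemma isometry_distE (x y : X) : mdist x y = ratr `|val (f x) - val (f y)|.
Proof. by rewrite -fI.1. Qed.

Lemma isometry_lift (q : rat) : q \in G -> exists x, val (f x) = q.
Proof. by move=> qG; have [x xq] := fI.2 (exist _ q qG); exists x; rewrite xq. Qed.

Lemma isometry_distances : distances X = nonneg_part (real_image G).
Proof.
apply/seteqP; split=> r.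
- move=> [x [y <-]]; rewrite isometry_distE; split; last by rewrite /= ler0q.
  exists `|val (f x) - val (f y)| => //=.
  have dG := rpredB (valP (f x)) (valP (f y)).
  by case: ger0P; rewrite ?rpredN.
- move=> [[q qG <-]]; rewrite /= ler0q => q0.
  have [x xq] := isometry_lift qG; have [y y0] := isometry_lift (rpred0 G).
  by exists x, y; rewrite isometry_distE xq y0 subr0 ger0_norm.
Qed.

(** In [G], the sphere of radius q around c is {c + q, c - q}; its preimage under [f] is the
    required sphere. *)
Lemma isometry_Banakh : Banakh_space X.
Proof.
move=> c r; rewrite isometry_distances => -[[q qG <-]]; rewrite /= ler0q => q0.
have cG := valP (f c).
have [x xE] := isometry_lift (rpredD cG qG).
have [y yE] := isometry_lift (rpredB cG qG).
have fi u v : val (f u) = val (f v) -> u = v.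
  move=> uv; apply: (@mdist_positivity R); rewrite isometry_distE uv.
  by rewrite subrr normr0 rmorph0.
exists x, y; split; last first.
  rewrite isometry_distE xE yE.
  have -> : val (f c) + q - (val (f c) - q) = 2 * q by ring.
  by rewrite ger0_norm ?mulr_ge0 // rmorphM /= ratr_nat.
apply/seteqP; split=> z.
- rewrite /sphere /= isometry_distE => /fmorph_inj zc.
  have : (val (f z) - val (f c) == q) || (val (f z) - val (f c) == - q).
    by rewrite -eqr_norm2 zc ger0_norm.
  case/orP=> /eqP zq.
  + by left; apply: fi; rewrite xE -zq; ring.
  + by right; apply: fi; rewrite yE -[q]opprK -zq; ring.
- case=> ->; rewrite /sphere /= isometry_distE ?xE ?yE.
  + by rewrite addrC addKr ger0_norm.
  + by rewrite addrC addKr normrN ger0_norm.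
Qed.

End FromIsometry.

Theorem theorem7p1 (R : realType) (G : zmodClosed rat) (X : metricType R) :
  isometric X (rat_space R G) <->
  Banakh_space X /\ distances X = nonneg_part (real_image G).
Proof.
split=> [[f fI]|[XB XG]]; last exact: Banakh_isometric.
by split; [exact: isometry_Banakh fI|exact: isometry_distances fI].
Qed.
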